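(* Let $T:\mathbb{N}\to\mathbb{N}$ be the Collatz map and $S=T\circ T\circ T$ its third iterate. For $n\in\mathbb{N}$ one has $$S(n)=\begin{cases} \frac{n}{8} & \text{if } n\in\mathcal{B}(0,8),\\ \frac{6n+2}{8} & \text{if } n\in\mathcal{B}(1,8),\\ \frac{6n+4}{8} & \text{if } n\in\mathcal{B}(2,8),\\ \frac{36n+20}{8} & \text{if } n\in\mathcal{B}(3,8),\\ \frac{6n+8}{8} & \text{if } n\in\mathcal{B}(4,8),\\ \frac{6n+2}{8} & \text{if } n\in\mathcal{B}(5,8),\\ \frac{6n+4}{8} & \text{if } n\in\mathcal{B}(6,8),\\ \frac{36n+20}{8} & \text{if } n\in\mathcal{B}(7,8). \end{cases}$$
   Context: $\mathbb{N}$ denotes the positive integers. The Collatz map $T:\mathbb{N}\to\mathbb{N}$ is $T(n)=n/2$ if $n$ is even and $T(n)=3n+1$ if $n$ is odd. For $i\in\{0,\dots,7\}$, $\mathcal{B}(i,8)=\{n\in\mathbb{N}:\exists m\in\mathbb{N}\cup\{0\},\ n=i+8m\}$. *)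

(* Defs.v *)
From mathcomp Require Import all_boot all_order all_algebra.

Set Implicit Arguments.
Unset Strict Implicit.
Unset Printing Implicit Defensive.

(* The positive integers are the n : nat with 0 < n; both functions below are
   total on nat, and their value at 0 is irrelevant. *)
Definition collatz (n : nat) : nat := if odd n then 3 * n + 1 else n./2.

Definition collatz3 : nat -> nat := collatz \o collatz \o collatz.

Definition arith_class (i k n : nat) : Prop :=
  0 < n /\ exists m : nat, n = i + k * m.

(* Main.v *)
Require Import Defs.
From mathcomp Require Import all_boot all_order all_algebra.
From mathcomp Require Import zify.

(** The parity of [i + 2 * k] is that of [i], so on each residue class modulo 2
the Collatz map is affine: raising the argument by [2 * k] raises the value by
[k] on the even class and by [6 * k] on the odd one ([collatz_shift]).  A shift
of the argument by [8 * m] can be halved three times in this way, so the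
parities met along the three steps from [i + 8 * m] are those met from [i], and
the third iterate is affine in [m] on each class modulo 8; its slope is the
product of the three one-step slopes ([collatz3_shift]).  Each formula is then
determined by the orbit of a single residue [i], which is computed, and the
identity of natural numbers [8 * collatz3 n = a * n + b] becomes the stated
quotient over the rationals ([natr_affine_div8]). *)

(** Twice the slope of the branch of the Collatz map that applies to [i]; the
factor 2 keeps the halving branch integral. *)
Definition collatz_slope (i : nat) : nat := if odd i then 6 else 1.

Lemma collatz_shift (i k : nat) :
  collatz (i + 2 * k) = collatz i + collatz_slope i * k.
Proof.
rewrite /collatz /collatz_slope oddD oddM /= addbF.
case: (odd i); first lia.
by rewrite mul2n halfD odd_double andbF doubleK add0n mul1n.
Qed.

(** Each step uses up one factor 2 of the shift, and what remains is still even
at the next step, so the parity of the running value never depends on [m]. *)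
Lemma collatz3_shift (i m : nat) :
  collatz3 (i + 8 * m) =
    collatz3 i + collatz_slope i * collatz_slope (collatz i)
                 * collatz_slope (collatz (collatz i)) * m.
Proof.
rewrite /collatz3 /=; set s0 := collatz_slope i.
have -> : 8 * m = 2 * (4 * m) by lia.
rewrite collatz_shift -/s0.
have -> : s0 * (4 * m) = 2 * (s0 * (2 * m)) by lia.
rewrite collatz_shift; set s1 := collatz_slope (collatz i).
have -> : s1 * (s0 * (2 * m)) = 2 * (s0 * s1 * m) by lia.
by rewrite collatz_shift mulnA [_ * (s0 * s1)]mulnC.
Qed.

Local Open Scope ring_scope.
Import GRing.Theory.

Lemma natr_affine_div8 (a b n x : nat) :
  (8 * x = a * n + b)%N -> x%:R = (a%:R * n%:R + b%:R) / 8 :> rat.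
Proof. by move=> e; rewrite -natrM -natrD -e natrM mulrC mulKf. Qed.

Theorem proposition1 (n : nat) (hn : (0 < n)%N) :
  (arith_class 0 8 n -> (collatz3 n)%:R = n%:R / 8 :> rat) /\
  (arith_class 1 8 n -> (collatz3 n)%:R = (6 * n%:R + 2) / 8 :> rat) /\
  (arith_class 2 8 n -> (collatz3 n)%:R = (6 * n%:R + 4) / 8 :> rat) /\
  (arith_class 3 8 n -> (collatz3 n)%:R = (36 * n%:R + 20) / 8 :> rat) /\
  (arith_class 4 8 n -> (collatz3 n)%:R = (6 * n%:R + 8) / 8 :> rat) /\
  (arith_class 5 8 n -> (collatz3 n)%:R = (6 * n%:R + 2) / 8 :> rat) /\
  (arith_class 6 8 n -> (collatz3 n)%:R = (6 * n%:R + 4) / 8 :> rat) /\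
  (arith_class 7 8 n -> (collatz3 n)%:R = (36 * n%:R + 20) / 8 :> rat).
Proof.
have affine i a b : (8 * collatz3 i = a * i + b)%N ->
    (collatz_slope i * collatz_slope (collatz i)
     * collatz_slope (collatz (collatz i)) = a)%N ->
    arith_class i 8 n -> (collatz3 n)%:R = (a%:R * n%:R + b%:R) / 8 :> rat.
  move=> value slope [_ [m ->]]; apply: natr_affine_div8.
  by rewrite collatz3_shift slope mulnDr value; lia.
split; first by rewrite -[n%:R]mul1r -[1 * _]addr0; apply: (affine 0 1 0)%N.
by do ![split]; apply: affine.
Qed.
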